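(* Let $R$ be an integral domain and let $M$ be a nonzero, non-simple multiplication $R$-module such that $\operatorname{ann}(M)$ is a prime ideal of $R$. Then $D(M)$ is a connected and path connected space.
   Context: For $m,n\in M$ write $m\mid n$ if $n=rm$ for some $r\in R$ (equivalently $Rn\subseteq Rm$). Put $M^{\#}=\{0\neq m\in M: Rm\neq M\}$ and define an equivalence relation on $M^{\#}$ by $m\sim n$ iff $Rm=Rn$; let $[m]$ be the class of $m$ and $\operatorname{EC}(M^{\#})=\{[m]:m\in M^{\#}\}$. For $m\in M^{\#}$ let $U_m=\{[n]\in \operatorname{EC}(M^{\#}): n\mid m\}$. The family $\{U_m\}_{m\in M^{\#}}$ is a basis of a topology on $\operatorname{EC}(M^{\#})$, called the divisor topology of $M$ and denoted $D(M)$ (also denoting the resulting space). $M$ is a multiplication module if each submodule $N$ of $M$ has the form $N=IM$ for some ideal $I$ of $R$. $\operatorname{ann}(M)=\{r\in R: rM=0\}$. *)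

(* Defs.v *)
From HB Require Import structures.
From mathcomp Require Import all_boot all_order all_algebra.
From mathcomp Require Import all_classical all_reals all_analysis.
Import Order.TTheory GRing.Theory Num.Theory numFieldNormedType.Exports.

Set Implicit Arguments.
Unset Strict Implicit.
Unset Printing Implicit Defensive.

Local Open Scope classical_set_scope.
Local Open Scope ring_scope.

(* Subsets are classical sets; [mem] casts them to the boolean predicates
   expected by the closure conditions of ssralg and ring_quotient. *)

Definition submodule (R : comNzRingType) (M : lmodType R) (N : set M) : Prop :=
  submod_closed (mem N).

(* Ideals need not be proper here, so they are submodules of R^o:
   [idealr_closed] would impose [1 \notin I]. *)
Definition ideal (R : comNzRingType) (I : set R) : Prop :=
  @submodule R R^o I.

Definition prime_ideal (R : comNzRingType) (I : set R) : Prop :=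
  idealr_closed (mem I) /\ prime_idealr_closed (mem I).

Definition ideal_smul (R : comNzRingType) (M : lmodType R) (I : set R) :
    set M :=
  [set x | exists n (a : 'I_n -> R) (v : 'I_n -> M),
    (forall i, I (a i)) /\ x = \sum_(i < n) a i *: v i].
Arguments ideal_smul {R} M I _.

Definition ann (R : comNzRingType) (M : lmodType R) : set R :=
  [set r | forall m : M, r *: m = 0].
Arguments ann {R} M _.

Definition nonzero_module (R : comNzRingType) (M : lmodType R) : Prop :=
  exists m : M, m <> 0.

Definition simple_module (R : comNzRingType) (M : lmodType R) : Prop :=
  nonzero_module M /\
  forall N : set M, submodule N -> N = [set 0] \/ N = [set: M].

Definition multiplication_module (R : comNzRingType) (M : lmodType R) : Prop :=
  forall N : set M, submodule N ->
    exists I : set R, ideal I /\ N = ideal_smul M I.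

Definition cyclic_sub (R : comNzRingType) (M : lmodType R) (m : M) : set M :=
  [set r *: m | r in [set: R]].

Definition divides (R : comNzRingType) (M : lmodType R) (m n : M) : Prop :=
  exists r : R, n = r *: m.

Definition sharp (R : comNzRingType) (M : lmodType R) : set M :=
  [set m | m <> 0 /\ cyclic_sub m <> [set: M]].
Arguments sharp {R} M _.

(* The class [m], encoded as a set of elements of M; it is only meaningful for
   [m] in [sharp M]. *)
Definition eqclass (R : comNzRingType) (M : lmodType R) (m : M) : set M :=
  [set n | sharp M n /\ cyclic_sub m = cyclic_sub n].

Definition EC (R : comNzRingType) (M : lmodType R) : set (set M) :=
  [set eqclass m | m in sharp M].
Arguments EC {R} M _.

(* The underlying type of D(M): the subtype of the elements of [EC M]. *)
Definition divisor_space (R : comNzRingType) (M : lmodType R) : Type :=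
  set_type (EC M).

HB.instance Definition _ (R : comNzRingType) (M : lmodType R) :=
  Choice.copy (divisor_space M) (set_type (EC M)).

(* The set U_m. The choice of the representative [n] of [c] is immaterial. *)
Definition basic_open (R : comNzRingType) (M : lmodType R) (m : M) :
    set (divisor_space M) :=
  [set c | exists n, [/\ sharp M n, val c = eqclass n & divides n m]].

Definition basic_opens (R : comNzRingType) (M : lmodType R) :
    set (set (divisor_space M)) :=
  [set basic_open m | m in sharp M].
Arguments basic_opens {R} M _.

Lemma divides_trans (R : comNzRingType) (M : lmodType R) (m n p : M) :
  divides m n -> divides n p -> divides m p.
Proof. by move=> [r ->] [s ->]; exists (s * r); rewrite scalerA. Qed.

Lemma divides_refl (R : comNzRingType) (M : lmodType R) (m : M) : divides m m.
Proof. by exists 1; rewrite scale1r. Qed.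

Lemma eqclass_divides (R : comNzRingType) (M : lmodType R) (m n : M) :
  sharp M n -> eqclass m = eqclass n -> divides m n.
Proof.
move=> Sn mn; have : eqclass n n by [].
rewrite -mn => -[_ mnE].
have : cyclic_sub n n by exists 1; rewrite ?scale1r.
by rewrite -mnE => -[r _ <-]; exists r.
Qed.

Lemma basic_opens_cover (R : comNzRingType) (M : lmodType R) :
  \bigcup_(U in basic_opens M) U = [set: divisor_space M].
Proof.
apply/seteqP; split=> // c _; have /set_mem[m Sm cm] := valP c.
exists (basic_open m); first by exists m.
by exists m; split=> //; exact: divides_refl.
Qed.

Lemma basic_opens_join (R : comNzRingType) (M : lmodType R)
    (U V : set (divisor_space M)) c :
  basic_opens M U -> basic_opens M V -> U c -> V c ->
  exists W, [/\ basic_opens M W, W c & W `<=` U `&` V].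
Proof.
move=> [m Sm <-] [n Sn <-] [k [Sk ck km]] [l [Sl cl ln]].
have kl : divides k l by apply: eqclass_divides; rewrite // -ck -cl.
have lk : divides l k by apply: eqclass_divides; rewrite // -ck -cl.
exists (basic_open k); split; first by exists k.
  by exists k; split=> //; exact: divides_refl.
move=> d [p [Sp dp pk]]; split; exists p; split=> //.
  exact: divides_trans km.
exact: divides_trans (divides_trans pk kl) ln.
Qed.

HB.instance Definition _ (R : comNzRingType) (M : lmodType R) :=
  @isBaseTopological.Build (divisor_space M) (set (divisor_space M))
    (basic_opens M) id (@basic_opens_cover R M) (@basic_opens_join R M).

Definition path_connected (K : realType) (T : topologicalType) : Prop :=
  forall x y : T, exists f : K -> T,
    [/\ {within `[0, 1], continuous f}, f 0 = x & f 1 = y].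

(* Main.v *)
(** Since [ann M] is prime, any two nonzero cyclic submodules [Rm = IM] and
    [Rn = JM] meet nontrivially: if [a] in [I] and [b] in [J] do not annihilate
    [M], neither does [ab], and [abM] lies in [Rm] and in [Rn]. Hence [m] and
    [n] have a common multiple [k <> 0], and every neighbourhood of [[k]]
    contains both [[m]] and [[n]]; so the map equal to [[m]] before [1/2],
    [[k]] at [1/2] and [[n]] after [1/2] is a path from [[m]] to [[n]]. *)
Require Import Defs.
From HB Require Import structures.
From mathcomp Require Import all_boot all_order all_algebra.
From mathcomp Require Import all_classical all_reals all_analysis.
Import Order.TTheory GRing.Theory Num.Theory numFieldNormedType.Exports.
Local Open Scope classical_set_scope.
Local Open Scope ring_scope.

(** In the specialization order, [k] is a common specialization of [x] and [y]: it lies in the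
    closure of each of the two points. *)
Definition common_generization (T : topologicalType) (x y k : T) : Prop :=
  forall U : set T, nbhs k U -> U x /\ U y.

(** If [B] is clopen, then [B] or its complement is a neighbourhood of [k], and so contains both [x]
    and [y]; hence no clopen set separates two points. *)
Lemma common_generization_connected (T : topologicalType) :
  (forall x y : T, exists k, common_generization T x y k) ->
  connected [set: T].
Proof.
move=> xyk B [x Bx] [C oC]; rewrite setTI => BC [D cD]; rewrite setTI => BD.
apply/seteqP; split=> // y _; have [k kxy] := xyk x y.
have [Bk|nBk] := pselect (B k).
  have [] // := kxy B _; apply: open_nbhs_nbhs; split=> //.
  by rewrite BC.
have [] // := kxy (~` B) _; apply: open_nbhs_nbhs; split=> //.
by rewrite BD; exact: closed_openC.
Qed.

Lemma common_generization_path_connected (K : realType) (T : topologicalType) :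
  (forall x y : T, exists k, common_generization T x y k) ->
  path_connected K T.
Proof.
move=> xyk x y; have [k kxy] := xyk x y.
pose f (t : K) := if t < 2^-1 then x else if t == 2^-1 then k else y.
have fx t : t < 2^-1 -> f t = x by rewrite /f => ->.
have fy t : 2^-1 < t -> f t = y by move=> tgt; rewrite /f ltNge ltW//= gt_eqF.
have fk : f 2^-1 = k by rewrite /f ltxx eqxx.
exists f; split; last 2 first.
- by apply: fx; rewrite invr_gt0 ltr0n.
- by apply: fy; rewrite invf_lt1 ?ltr0n ?ltr1n.
apply: continuous_subspaceT => t U fU.
suff : \forall s \near t, U (f s) by [].
case: (ltgtP t 2^-1) => [tlt|tgt|tE].
- move: fU; rewrite fx// => /nbhs_singleton Ux.
  by near=> s; rewrite fx//; near: s; exact: lt_nbhsl.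
- move: fU; rewrite fy// => /nbhs_singleton Uy.
  by near=> s; rewrite fy//; near: s; exact: lt_nbhsr.
(* At [1/2] nothing needs to be small: [x], [k] and [y] all lie in [U], so the preimage of [U] is
   the whole line. *)
- move: fU; rewrite tE fk => kU; have [Ux Uy] := kxy _ kU.
  apply: filterE => s; case: (ltgtP s 2^-1) => [/fx ->//|/fy ->//|->].
  by rewrite fk; exact: nbhs_singleton.
Unshelve. all: by end_near. Qed.

Lemma cyclic_sub_submodule (R : comNzRingType) (M : lmodType R) (m : M) :
  submodule (cyclic_sub m).
Proof.
split=> [|a u v /set_mem[r _ <-] /set_mem[s _ <-]]; apply/mem_set.
  by exists 0; rewrite ?scale0r.
by exists (a * r + s); rewrite // scalerDl scalerA.
Qed.

Lemma ideal_smul_mem (R : comNzRingType) (M : lmodType R) (I : set R) a v :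
  I a -> ideal_smul M I (a *: v).
Proof.
by move=> Ia; exists 1, (fun=> a), (fun=> v); split=> //; rewrite big_ord1.
Qed.

(** Write [Rm = IM]. If [I] were contained in [ann M], then [Rm] would vanish; so some [a] in [I] is
    outside [ann M], and [aM] lies in [IM = Rm]. *)
Lemma cyclic_sub_non_ann (R : comNzRingType) (M : lmodType R) (m : M) :
  multiplication_module M -> m <> 0 ->
  exists2 a, ~ ann M a & forall v : M, divides m (a *: v).
Proof.
move=> mulM m0; have [I [_ mI]] := mulM _ (cyclic_sub_submodule _ _ m).
have [a Ia na] : exists2 a, I a & ~ ann M a.
  apply: contrapT => noa; apply: m0.
  have : cyclic_sub m m by exists 1; rewrite ?scale1r.
  rewrite mI => -[n [a [v [Ia ->]]]]; apply: big1 => i _.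
  have : ann M (a i) by apply: contrapT => nai; apply: noa; exists (a i).
  exact.
exists a => // v; have := ideal_smul_mem _ _ _ _ v Ia.
by rewrite -mI => -[r _ rm]; exists r.
Qed.

Lemma common_multiple (R : comNzRingType) (M : lmodType R) (m n : M) :
  multiplication_module M -> prime_ideal (ann M) -> m <> 0 -> n <> 0 ->
  exists k : M, [/\ k <> 0, divides m k & divides n k].
Proof.
move=> mulM [_ primeM] m0 n0.
have [a na am] := cyclic_sub_non_ann _ _ _ mulM m0.
have [b nb bn] := cyclic_sub_non_ann _ _ _ mulM n0.
have nab : ~ ann M (a * b).
  by move=> /mem_set/primeM/orP[] /set_mem.
have /existsNP[v abv] := nab.
exists ((a * b) *: v); split=> //; first by rewrite -scalerA; exact: am.
by rewrite mulrC -scalerA; exact: bn.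
Qed.

(** As [Rk] lies in [Rm], it cannot be all of [M]. This makes the common multiple a point of the
    space. *)
Lemma sharp_divides (R : comNzRingType) (M : lmodType R) (m k : M) :
  sharp M m -> k <> 0 -> divides m k -> sharp M k.
Proof.
move=> [_ mM] k0 [r kE]; split=> // kM; apply: mM.
apply/seteqP; split=> // v _; have : cyclic_sub k v by rewrite kM.
by move=> [s _ <-]; exists (s * r); rewrite // kE scalerA.
Qed.

(** Each point has a smallest neighbourhood, so testing [U_m] suffices for all neighbourhoods of
    [[m]]. *)
Lemma nbhs_basic_open (R : comNzRingType) (M : lmodType R) (m : M)
    (c : divisor_space M) (U : set (divisor_space M)) :
  sharp M m -> val c = eqclass m -> nbhs c U -> basic_open m `<=` U.
Proof.
move=> Sm cm; rewrite nbhsE => -[V [[B sB <-] [W BW Wc]] VU].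
apply: subset_trans VU => d [p [Sp dp pm]]; exists W => //.
have [n Sn Wn] := sB _ BW; move: Wc; rewrite -Wn => -[q [Sq cq qn]].
(* The chain is [p | m | q | n], where [m] and [q] represent the same class [c]. *)
exists p; split=> //; apply: divides_trans qn; apply: divides_trans pm _.
by apply: eqclass_divides; rewrite // -cm.
Qed.

Lemma divisor_space_common_generization (R : comNzRingType) (M : lmodType R) :
  multiplication_module M -> prime_ideal (ann M) ->
  forall x y : divisor_space M, exists k, common_generization _ x y k.
Proof.
move=> mulM primeM x y.
have /set_mem[m Sm mx] := valP x; have /set_mem[n Sn ny] := valP y.
have [k [k0 mk nk]] := common_multiple _ _ _ _ mulM primeM Sm.1 Sn.1.
have Sk := sharp_divides _ _ _ _ Sm k0 mk.
have ECk : eqclass k \in EC M by apply/mem_set; exists k.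
pose c : divisor_space M := SigSub ECk.
have ck : val c = eqclass k by [].
exists c => U /(nbhs_basic_open _ _ _ _ _ Sk ck) kU.
by split; apply: kU; [exists m|exists n].
Qed.

Theorem corollary3 (K : realType) (R : idomainType) (M : lmodType R) :
  nonzero_module M ->
  ~ simple_module M ->
  multiplication_module M ->
  prime_ideal (ann M) ->
  connected [set: divisor_space M] /\ path_connected K (divisor_space M).
Proof.
move=> _ _ mulM primeM.
have gen := divisor_space_common_generization _ _ mulM primeM.
split; first exact: common_generization_connected.
exact: common_generization_path_connected.
Qed.
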